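(* Let $B$ be a basis such that $E_B = A_B^{-1}D_B$ is diagonalizable, with eigendecomposition $E_B=Q\Sigma Q^{-1}$. After a preprocessing that does not depend on $\lambda$, for any given $\lambda$ such that $I+\lambda E_B$ is invertible, $x_B(\lambda)$ can be computed in $\mathcal{O}(m^2)$ and $o_B(\lambda)$ can be computed in $\mathcal{O}(m)$.
   Context: Let $A, D \in \mathbb{R}^{m\times n}$, $b\in\mathbb{R}^m$, $c\in\mathbb{R}^n$, and for $\lambda\in\mathbb{R}$ let $\mathcal{P}(\lambda)$ be the linear program $\min\{c^T x : Ax+\lambda Dx=b,\ x\ge 0\}$. A basis $B$ is a choice of $m$ column indices such that $A_B$ is invertible; $M_B$ denotes the submatrix of a matrix $M$ (or subvector of a vector) formed by the columns (entries) indexed by $B$. Whenever $A_B+\lambda D_B$ is invertible (equivalently $I+\lambda E_B$ is invertible), $x_B(\lambda) = (A_B+\lambda D_B)^{-1}b$ and $o_B(\lambda) = c_B^T x_B(\lambda)$. Complexity is the number of arithmetic operations over $\mathbb{C}$ (unit cost). The matrices $Q,\Sigma,Q^{-1}$, the vector $x_B(0)=A_B^{-1}b$, and any other quantity not depending on $\lambda$ may be computed once in the preprocessing, whose cost is not counted in the per-$\lambda$ cost. *)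

(* Defs.v *)
From mathcomp Require Import all_boot all_order all_algebra.
From mathcomp Require Import reals.
From mathcomp Require Import complex.

Set Implicit Arguments.
Unset Strict Implicit.
Unset Printing Implicit Defensive.

Import Order.TTheory GRing.Theory Num.Theory.
Local Open Scope ring_scope.

(* Algebraic (unit-cost) model of computation: straight-line programs without
   built-in constants.  Registers are numbered from 0; the inputs occupy the
   first registers and each instruction (op, i, j) appends a new register
   holding (register i) op (register j). *)

Inductive arith_op := Add | Sub | Mul | Div.

Record slp := Slp {
  slp_code : seq (arith_op * nat * nat);
  slp_outputs : seq nat  (* registers holding the results *)
}.

Definition slp_cost (p : slp) : nat := size (slp_code p).

(* Division by zero is an execution failure, despite x / 0 = 0 in MathComp. *)
Definition arith_eval (F : fieldType) (op : arith_op) (x y : F) : option F :=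
  match op with
  | Add => Some (x + y)
  | Sub => Some (x - y)
  | Mul => Some (x * y)
  | Div => if y == 0 then None else Some (x / y)
  end.

Fixpoint slp_exec (F : fieldType) (code : seq (arith_op * nat * nat))
    (regs : seq F) : option (seq F) :=
  match code with
  | [::] => Some regs
  | (op, i, j) :: code' =>
      match onth regs i, onth regs j with
      | Some x, Some y =>
          match arith_eval op x y with
          | Some z => slp_exec code' (rcons regs z)
          | None => None
          end
      | _, _ => None
      end
  end.

Definition slp_computes (F : fieldType) (p : slp) (xs ys : seq F) : Prop :=
  exists2 regs, slp_exec (slp_code p) xs = Some regs
    & [seq onth regs k | k <- slp_outputs p] = [seq Some y | y <- ys].

Section ParametricLP.
Variables (R : realType) (m n : nat).
Implicit Types (A D : 'M[R]_(m, n)) (b : 'cV[R]_m) (c : 'cV[R]_n).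
Implicit Types (B : 'I_m -> 'I_n) (lambda : R).

(* B lists the chosen column indices; they are pairwise distinct because a
   matrix with a repeated column is not invertible. *)
Definition is_basis A B : Prop := colsub B A \in unitmx.

Definition E_B A D B : 'M[R]_m := invmx (colsub B A) *m colsub B D.

(* x_B and o_B are meaningful only when A_B + lambda D_B is invertible. *)
Definition x_B A D b B lambda : 'cV[R]_m :=
  invmx (colsub B A + lambda *: colsub B D) *m b.

Definition o_B A D b c B lambda : R :=
  ((rowsub B c)^T *m x_B A D b B lambda) ord0 ord0.

(* The decomposition is over the complex numbers, although E is real. *)
Definition eigendecomposition (E : 'M[R]_m) (Q Sigma : 'M[R[i]]_m) : Prop :=
  [/\ Q \in unitmx, is_diag_mx Sigma
    & map_mx (real_complex R) E = Q *m Sigma *m invmx Q].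

End ParametricLP.

(* Main.v *)
Require Import Defs.
From mathcomp Require Import all_boot all_order all_algebra.
From mathcomp Require Import reals.
From mathcomp Require Import complex.

Import Order.TTheory GRing.Theory Num.Theory.
Local Open Scope ring_scope.

Set Implicit Arguments.
Unset Strict Implicit.
Unset Printing Implicit Defensive.

(** Since [A_B + lambda D_B = A_B (I + lambda E_B)], the vector [x_B(lambda)]
    solves [(I + lambda E_B) x = x0] with [x0 = A_B^-1 b].  In the eigenbasis
    [I + lambda E_B = Q (I + lambda Sigma) Q^-1] becomes diagonal, so with
    [v = Q^-1 x0]
      [x_i = \sum_k Q_ik v_k / (1 + lambda sigma_k)],
    and hence also
      [o = \sum_k (c_B^T Q)_k v_k / (1 + lambda sigma_k)]
    ([eigenbasis_solution], [x_B_linear_system]).  No denominator vanishes, by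
    invertibility of [I + lambda E_B].

    Both results are therefore values of one kind of expression: a sum of [m]
    fractions [w_k / (1 + lambda sigma_k)] whose weights [w_k] and eigenvalues
    [sigma_k] are independent of [lambda], so that they belong to the
    preprocessing.  Evaluating one such sum takes four operations per term
    ([exec_row], [size_row_code]), so [4 m] operations for [o] and, repeating
    this for each of the [m] coordinates, [4 m ^ 2] operations for [x]
    ([exec_rows], [fractions_slp_cost]).  Recomputing the denominators for
    each coordinate only affects the constant. *)

(** * Straight-line programs *)

Section Programs.
Variable F : fieldType.
Implicit Types (regs e : seq F) (code : seq (arith_op * nat * nat)).

Lemma onth_cat_Some regs e i x :
  onth regs i = Some x -> onth (regs ++ e) i = Some x.
Proof. by move=> ri; rewrite onth_cat -onthTE ri. Qed.

Lemma onth_rcons_size regs x : onth (rcons regs x) (size regs) = Some x.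
Proof. by rewrite -cats1 onth_cat ltnn subnn. Qed.

Lemma slp_exec_cat code1 code2 regs :
  slp_exec (code1 ++ code2) regs
  = obind (slp_exec code2) (slp_exec code1 regs).
Proof.
elim: code1 regs => [//|[[op i] j] code1 IH] regs /=.
by case: (onth regs i) (onth regs j) => [x|] [y|] //; case: arith_eval.
Qed.

Lemma slp_exec_cons op i j code regs x y z :
    onth regs i = Some x -> onth regs j = Some y ->
    arith_eval op x y = Some z ->
  slp_exec ((op, i, j) :: code) regs = slp_exec code (rcons regs z).
Proof. by move=> /= -> -> ->. Qed.

(** Execution only appends registers, so that values already computed stay
    readable at the same place. *)
Lemma slp_exec_extends {code regs regs'} :
    slp_exec code regs = Some regs' ->
  exists2 e, regs' = regs ++ e & size e = size code.
Proof.
elim: code regs => [|[[op i] j] code IH] regs /=.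
  by case=> <-; exists [::]; rewrite ?cats0.
case: (onth regs i) (onth regs j) => [x|] [y|] //.
case: arith_eval => // z /IH[e -> <-]; exists (z :: e) => //.
by rewrite cat_rcons.
Qed.

(** * Evaluating sums of fractions with denominators affine in lambda *)

(** Partial sums of [\sum_k w_k / (1 + lambda * sigma_k)], starting from the
    value of register [acc]; [s] is the number of registers in use.  Register 0 holds [lambda] and register 2 holds
    1, while [sigma k] and [weight k] are the registers of [sigma_k] and
    [w_k]. *)
Fixpoint row_code (T : Type) (sigma weight : T -> nat) (acc s : nat)
    (ks : seq T) : seq (arith_op * nat * nat) :=
  if ks is k :: ks' then
    [:: (Mul, 0, sigma k); (Add, 2, s); (Div, weight k, s.+1);
        (Add, acc, s.+2)]%N ++ row_code sigma weight s.+3 s.+4 ks'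
  else [::].

(** The register of the result; it is [acc] itself for the empty sum, so that
    an empty sum costs nothing. *)
Fixpoint row_out (T : Type) (acc s : nat) (ks : seq T) : nat :=
  if ks is _ :: ks' then row_out s.+3 s.+4 ks' else acc.

Lemma size_row_code T (sigma weight : T -> nat) acc s ks :
  size (row_code sigma weight acc s ks) = (4 * size ks)%N.
Proof. by elim: ks acc s => [//|k ks IH] acc s /=; rewrite IH mulnS. Qed.

(** Each term appends four registers: [lambda * sigma_k], the denominator, the
    fraction, and the new partial sum, which is the next accumulator. *)
Lemma exec_row T (sigma weight : T -> nat) (sv wv : T -> F) lambda acc a
    regs ks :
    onth regs 0 = Some lambda -> onth regs 2 = Some 1 ->
    onth regs acc = Some a ->
    (forall k, onth regs (sigma k) = Some (sv k)) ->
    (forall k, onth regs (weight k) = Some (wv k)) ->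
    (forall k, 1 + lambda * sv k != 0) ->
  exists2 regs',
      slp_exec (row_code sigma weight acc (size regs) ks) regs = Some regs'
    & onth regs' (row_out acc (size regs) ks)
      = Some (a + \sum_(k <- ks) wv k / (1 + lambda * sv k)).
Proof.
move=> + + + + + nz.
elim: ks acc a regs => [|k ks IH] acc a regs r0 r2 racc rsigma rweight.
  by exists regs; rewrite // big_nil addr0.
pose t1 := lambda * sv k; pose t2 := 1 + t1.
pose t3 := wv k / t2; pose t4 := a + t3.
have step code : slp_exec
    ([:: (Mul, 0, sigma k); (Add, 2, size regs); (Div, weight k, (size regs).+1);
        (Add, acc, (size regs).+2)]%N ++ code) regs
    = slp_exec code (regs ++ [:: t1; t2; t3; t4]).
  rewrite !cat_cons cat0s.
  rewrite (@slp_exec_cons _ _ _ _ _ _ _ t1 r0 (rsigma k)) //.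
  rewrite (@slp_exec_cons _ _ _ _ _ 1 t1 t2) //; first last.
  - exact: onth_rcons_size.
  - by rewrite -cats1; apply: onth_cat_Some.
  rewrite (@slp_exec_cons _ _ _ _ _ (wv k) t2 t3); first last.
  - by rewrite /= (negPf (nz k)).
  - by rewrite -(size_rcons regs t1) onth_rcons_size.
  - by rewrite -!cats1; do !apply: onth_cat_Some.
  rewrite (@slp_exec_cons _ _ _ _ _ a t3 t4) //; first last.
  - by rewrite -(size_rcons regs t1) -(size_rcons _ t2) onth_rcons_size.
  - by rewrite -!cats1; do !apply: onth_cat_Some.
  by rewrite -!cats1 -!catA.
have size4 : size (regs ++ [:: t1; t2; t3; t4]) = (size regs).+4.
  by rewrite size_cat addnC.
have [||||| regs' exec' out'] :=
    IH (size regs).+3 t4 (regs ++ [:: t1; t2; t3; t4]).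
- exact: onth_cat_Some.
- exact: onth_cat_Some.
- by rewrite onth_cat ltnNge leqW ?leqW //= -addn3 addKn.
- by move=> i; apply: onth_cat_Some.
- by move=> i; apply: onth_cat_Some.
exists regs'; first by rewrite /row_code -/row_code step -size4.
by rewrite /row_out -/row_out -size4 out' big_cons addrA.
Qed.

(** Several such sums in a row, each starting from the zero in register 1. *)
Fixpoint rows_code (I T : Type) (sigma : T -> nat) (weight : I -> T -> nat)
    (ks : seq T) (s : nat) (rs : seq I) : seq (arith_op * nat * nat) :=
  if rs is r :: rs' then
    row_code sigma (weight r) 1 s ks
      ++ rows_code sigma weight ks (s + 4 * size ks) rs'
  else [::].

Fixpoint rows_out (I T : Type) (ks : seq T) (s : nat) (rs : seq I) : seq nat :=
  if rs is r :: rs' then row_out 1 s ks :: rows_out ks (s + 4 * size ks) rs'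
  else [::].

Definition rows_slp (I T : Type) sigma weight ks s (rs : seq I) : slp :=
  Slp (@rows_code I T sigma weight ks s rs) (rows_out ks s rs).

Lemma rows_slp_cost I T sigma weight ks s rs :
  slp_cost (@rows_slp I T sigma weight ks s rs) = (4 * (size rs * size ks))%N.
Proof.
rewrite /slp_cost /=; elim: rs s => [//|r rs IH] s /=.
by rewrite size_cat size_row_code IH mulSn mulnDr.
Qed.

(** The inputs of a later row are not disturbed by the earlier rows, whose code
    appends exactly [4 * size ks] registers each. *)
Lemma exec_rows I T (sigma : T -> nat) (weight : I -> T -> nat)
    (sv : T -> F) (wv : I -> T -> F) lambda regs ks rs :
    onth regs 0 = Some lambda -> onth regs 1 = Some 0 ->
    onth regs 2 = Some 1 ->
    (forall k, onth regs (sigma k) = Some (sv k)) ->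
    (forall r k, onth regs (weight r k) = Some (wv r k)) ->
    (forall k, 1 + lambda * sv k != 0) ->
  slp_computes (rows_slp sigma weight ks (size regs) rs) regs
    [seq \sum_(k <- ks) wv r k / (1 + lambda * sv k) | r <- rs].
Proof.
move=> + + + + + nz; rewrite /slp_computes [slp_code _]/= [slp_outputs _]/=.
elim: rs regs => [|r rs IH] regs r0 r1 r2 rsigma rweight; first by exists regs.
have [regs1 exec1 out1] :=
  exec_row ks r0 r2 r1 rsigma (rweight r) nz.
have [e regs1E size_e] := slp_exec_extends exec1.
rewrite size_row_code in size_e.
have [||||| regs' exec' out'] := IH regs1; rewrite ?regs1E.
1-3: exact: onth_cat_Some.
- by move=> k; apply: onth_cat_Some.
- by move=> i k; apply: onth_cat_Some.
have size1 : size regs1 = (size regs + 4 * size ks)%N.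
  by rewrite regs1E size_cat size_e.
have [e' regs'E _] := slp_exec_extends exec'.
exists regs'; first by rewrite /= slp_exec_cat exec1 /= -size1.
rewrite /= -size1 out'; congr (_ :: _).
by rewrite {1}regs'E (onth_cat_Some _ out1) add0r.
Qed.

(** * Storing a finite family in consecutive registers *)

Lemma onth_codom (T : finType) (f : T -> F) x :
  onth (codom f) (enum_rank x) = Some (f x).
Proof.
rewrite codomE onth_map onthE (nth_map x) ?nth_enum_rank //.
by rewrite -cardE ltn_ord.
Qed.

(** The eigenvalues and the weights of the coordinates ([Some i]) and of the
    objective ([None]). *)
Definition params (m : nat) : finType := ('I_m + option 'I_m * 'I_m)%type.

(** The offset 3 accounts for [lambda] and the constants 0 and 1. *)
Definition param_reg {m} (p : params m) : nat := (3 + enum_rank p)%N.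

Definition fractions_slp (m : nat) (rs : seq (option 'I_m)) : slp :=
  rows_slp (fun k => param_reg (inl k : params m))
    (fun r k => param_reg (inr (r, k) : params m))
    (enum 'I_m) (3 + #|params m|) rs.

Lemma fractions_slp_cost m (rs : seq (option 'I_m)) :
  slp_cost (fractions_slp rs) = (4 * (size rs * m))%N.
Proof. by rewrite rows_slp_cost size_enum_ord. Qed.

Definition param_values m (sv : 'I_m -> F) (wv : option 'I_m -> 'I_m -> F) :
    seq F :=
  [:: 0, 1 & codom (fun p : params m =>
                      match p with inl k => sv k | inr (r, k) => wv r k end)].

Lemma fractions_slp_computes m (sv : 'I_m -> F) wv lambda rs :
    (forall k, 1 + lambda * sv k != 0) ->
  slp_computes (fractions_slp rs) (lambda :: param_values sv wv)
    [seq \sum_k wv r k / (1 + lambda * sv k) | r <- rs].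
Proof.
move=> nz; have -> : [seq \sum_k wv r k / (1 + lambda * sv k) | r <- rs]
    = [seq \sum_(k <- enum 'I_m) wv r k / (1 + lambda * sv k) | r <- rs].
  by apply: eq_map => r; rewrite big_enum.
have := exec_rows (sigma := fun k => param_reg (inl k : params m))
  (weight := fun r k => param_reg (inr (r, k) : params m)) (sv := sv) (wv := wv)
  (lambda := lambda) (regs := lambda :: param_values sv wv) (enum 'I_m) rs.
rewrite /= size_codom; apply=> // [k|r k]; exact: onth_codom.
Qed.

End Programs.

(** * Solving the linear system in the eigenbasis *)

(** Conjugation by [Q] turns the system into the [m] scalar equations
    [(1 + lambda * Sigma k k) * y_k = (Q^-1 x0)_k] with [y = Q^-1 x]; the
    determinant of the diagonal matrix, a product of these coefficients, is
    nonzero because the system is invertible. *)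
Lemma eigenbasis_solution (F : fieldType) m (E Q Sigma : 'M[F]_m)
    (x x0 : 'cV[F]_m) lambda :
    Q \in unitmx -> is_diag_mx Sigma -> E = Q *m Sigma *m invmx Q ->
    1%:M + lambda *: E \in unitmx -> (1%:M + lambda *: E) *m x = x0 ->
  (forall k, 1 + lambda * Sigma k k != 0) /\
  x = Q *m \col_k ((invmx Q *m x0) k ord0 / (1 + lambda * Sigma k k)).
Proof.
move=> uQ /diag_mxP[d ->] -> + <-; set E' := (_ + _).
pose t : 'rV_m := \row_k (1 + lambda * d ord0 k).
have -> : E' = Q *m diag_mx t *m invmx Q.
  have -> : diag_mx t = 1%:M + lambda *: diag_mx d.
    apply/matrixP => i j; rewrite !mxE.
    by case: eqP => [->|_]; rewrite ?mulr1n // !mulr0n mulr0 addr0.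
  by rewrite mulmxDr mulmxDl mulmx1 mulmxV // -scalemxAr -scalemxAl.
rewrite !unitmx_mul => /andP[/andP[_ ut] _].
have t_neq0 k : t ord0 k != 0.
  by move: ut; rewrite unitmxE det_diag unitfE => /prodf_neq0/(_ k isT).
have tE k : 1 + lambda * diag_mx d k k = t ord0 k.
  by rewrite !mxE eqxx mulr1n.
split=> [k|]; first by rewrite tE.
rewrite -[LHS](mulKVmx uQ); congr (Q *m _).
apply/matrixP => k j; rewrite ord1 [RHS]mxE tE.
by rewrite !mulmxA mulVmx // mul1mx -mulmxA mul_diag_mx mxE mulrC mulKf.
Qed.

(** Factor [A_B] out of [A_B + lambda D_B] on the left. *)
Lemma x_B_linear_system (R : realType) m n (A D : 'M[R]_(m, n)) b
    (B : 'I_m -> 'I_n) lambda :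
    is_basis A B -> 1%:M + lambda *: E_B A D B \in unitmx ->
  (1%:M + lambda *: E_B A D B) *m x_B A D b B lambda
  = invmx (colsub B A) *m b.
Proof.
move=> uA uE; have AD : colsub B A + lambda *: colsub B D
    = colsub B A *m (1%:M + lambda *: E_B A D B).
  by rewrite mulmxDr mulmx1 -scalemxAr /E_B mulKVmx.
have uAD : colsub B A + lambda *: colsub B D \in unitmx.
  by rewrite AD unitmx_mul uE andbT.
apply: (canRL (mulKmx uA)).
by rewrite mulmxA -AD /x_B mulKVmx.
Qed.

Theorem theorem2 (R : realType) :
  exists (Px Po : nat -> slp) (K : nat),
    (forall m : nat,
       (slp_cost (Px m) <= K * m ^ 2)%N /\ (slp_cost (Po m) <= K * m)%N) /\
    forall (m n : nat) (A D : 'M[R]_(m, n)) (b : 'cV[R]_m) (c : 'cV[R]_n)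
           (B : 'I_m -> 'I_n) (Q Sigma : 'M[R[i]%C]_m),
      is_basis A B ->
      eigendecomposition (E_B A D B) Q Sigma ->
      exists pre : seq R[i]%C,
        forall lambda : R,
          1%:M + lambda *: E_B A D B \in unitmx ->
          slp_computes (Px m) (real_complex R lambda :: pre)
            [seq real_complex R (x_B A D b B lambda i ord0) | i : 'I_m] /\
          slp_computes (Po m) (real_complex R lambda :: pre)
            [:: real_complex R (o_B A D b c B lambda)].
Proof.
exists (fun m => @fractions_slp m (codom Some)),
  (fun m => @fractions_slp m [:: None]).
exists 4; split=> [m|m n A D b c B Q Sigma uA [uQ dSigma EQ]].
  by rewrite !fractions_slp_cost size_codom card_ord mulnn mul1n.
pose toC := real_complex R.
pose v := invmx Q *m map_mx toC (invmx (colsub B A) *m b).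
(* Eigenbasis coordinates of [x0] are folded into the weights, which thus
   save one multiplication per term. *)
pose wv r k := match r with
  | Some i => Q i k
  | None => (map_mx toC (rowsub B c)^T *m Q) ord0 k
  end * v k ord0.
exists (param_values (fun k => Sigma k k) wv) => lambda uE.
have sys := congr1 (map_mx toC) (x_B_linear_system b uA uE).
(* The eigenvectors may be complex, so the real system is solved over [R[i]]. *)
have toE : map_mx toC (1%:M + lambda *: E_B A D B)
    = 1%:M + toC lambda *: map_mx toC (E_B A D B).
  by rewrite map_mxD map_mx1 map_mxZ.
rewrite map_mxM toE in sys; rewrite -(map_unitmx toC) toE in uE.
have [nz xE] := eigenbasis_solution uQ dSigma EQ uE sys.
have xvE i : toC (x_B A D b B lambda i ord0)
    = \sum_k wv (Some i) k / (1 + toC lambda * Sigma k k).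
  have /matrixP/(_ i ord0) := xE; rewrite [LHS]mxE => xiE; apply: etrans xiE _.
  by rewrite mxE; apply: eq_bigr => k _; rewrite mxE mulrA.
have oE : toC (o_B A D b c B lambda)
    = \sum_k wv None k / (1 + toC lambda * Sigma k k).
  transitivity ((map_mx toC (rowsub B c)^T *m map_mx toC (x_B A D b B lambda))
                  ord0 ord0).
    by rewrite -map_mxM mxE.
  rewrite xE mulmxA mxE; apply: eq_bigr => k _.
  by rewrite [X in _ * X]mxE mulrA.
split.
- have -> : [seq toC (x_B A D b B lambda i ord0) | i : 'I_m]
      = [seq \sum_k wv r k / (1 + toC lambda * Sigma k k) | r <- codom Some].
    by rewrite codomE -map_comp; apply: eq_map.
  exact: fractions_slp_computes.
- by rewrite -/toC oE; apply: (fractions_slp_computes wv [:: None] nz).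
Qed.
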